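(* Let $W:\mathbb{R}^2\times\mathbb{R}^2\times[0,1]\to\mathbb{R}^2$ be the function which assigns to $v_1,v_2\in\mathbb{R}^2$ and $\lambda\in[0,1]$ the point $z=W(v_1,v_2,\lambda)$ satisfying $$d^*(z,v_1)=(1-\lambda)\,d^*(v_1,v_2)\quad\text{and}\quad d^*(z,v_2)=\lambda\, d^*(v_1,v_2).$$ Then $W$ is a convex structure on $(\mathbb{R}^2,d^* )$, i.e. for all $v_1,v_2,v\in\mathbb{R}^2$ and all $\lambda\in[0,1]$, $$d^*(v,W(v_1,v_2,\lambda))\le \lambda\, d^*(v,v_1)+(1-\lambda)\,d^*(v,v_2).$$ Therefore $(\mathbb{R}^2,d^* )$ is a $W$-convex metric space.
   Context: The river metric $d^*$ on $\mathbb{R}^2$ is defined, for $v_1=(x_1,y_1)$ and $v_2=(x_2,y_2)$, by $d^*(v_1,v_2)=|y_1-y_2|$ if $x_1=x_2$, and $d^*(v_1,v_2)=|y_1|+|y_2|+|x_1-x_2|$ if $x_1\ne x_2$. A mapping $W:X^2\times[0,1]\to X$ on a metric space $(X,d)$ is a convex structure on $X$ if $d(u,W(x,y,\lambda))\le\lambda d(u,x)+(1-\lambda)d(u,y)$ for all $x,y,u\in X$ and $\lambda\in[0,1]$. A metric space with a convex structure $W$ is called a $W$-convex metric space. *)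

(* Defs.v *)
From HB Require Import structures.
From mathcomp Require Import all_boot all_order all_algebra.
From mathcomp Require Import all_classical all_reals all_analysis.
From mathcomp Require Import lra.

Set Implicit Arguments.
Unset Strict Implicit.
Unset Printing Implicit Defensive.

Import Order.TTheory GRing.Theory Num.Theory.

Local Open Scope ring_scope.

(* A copy of [R * R]; the alias keeps the river metric from clashing with the
   sup pseudometric that is canonical on the product type. *)
Definition river_plane (R : realType) : Type := (R * R)%type.

HB.instance Definition _ (R : realType) :=
  Choice.copy (river_plane R) (R * R)%type.

Definition river_dist (R : realType) (v1 v2 : river_plane R) : R :=
  if v1.1 == v2.1 then `|v1.2 - v2.2|
  else `|v1.2| + `|v2.2| + `|v1.1 - v2.1|.

Section RiverMetric.
Variable R : realType.
Implicit Types v : river_plane R.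

Lemma river_distxx v : river_dist v v = 0.
Proof. by rewrite /river_dist eqxx subrr normr0. Qed.

Lemma river_dist_positivity v1 v2 : river_dist v1 v2 = 0 -> v1 = v2.
Proof.
case: v1 v2 => [x1 y1] [x2 y2]; rewrite /river_dist /=.
case: eqVneq => [-> /eqP | ne].
  by rewrite normr_eq0 subr_eq0 => /eqP ->.
have d0 : 0 < `|x1 - x2| by rewrite normr_gt0 subr_eq0.
have p1 := normr_ge0 y1; have p2 := normr_ge0 y2.
by move=> d12; exfalso; lra.
Qed.

Lemma river_dist_sym v1 v2 : river_dist v1 v2 = river_dist v2 v1.
Proof.
rewrite /river_dist eq_sym distrC; case: ifP => // _.
by rewrite [`|v1.2| + _]addrC distrC.
Qed.

Lemma river_dist_triangle v2 v1 v3 :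
  river_dist v1 v3 <= river_dist v1 v2 + river_dist v2 v3.
Proof.
case: v1 v2 v3 => [x1 y1] [x2 y2] [x3 y3]; rewrite /river_dist /=.
have tx := ler_distD x2 x1 x3; have ty := ler_distD y2 y1 y3.
have n1 := ler_normB y1 y2; have n2 := ler_normB y2 y3.
have n3 := ler_normB y1 y3.
have m1 := lerB_dist y1 y2; have m2 := lerB_dist y3 y2.
rewrite [`|y3 - y2|]distrC in m2.
have p1 := normr_ge0 y1; have p2 := normr_ge0 y2; have p3 := normr_ge0 y3.
have q1 := normr_ge0 (x1 - x2); have q2 := normr_ge0 (x2 - x3).
case: (eqVneq x1 x2) => [e12|n12]; case: (eqVneq x2 x3) => [e23|n23];
  case: (eqVneq x1 x3) => [e13|n13]; try lra.
- by rewrite e12; lra.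
- by rewrite -e23; lra.
Qed.

End RiverMetric.

HB.instance Definition _ (R : realType) :=
  isMetric.Build R (river_plane R) (@river_distxx R)
    (@river_dist_positivity R) (@river_dist_sym R) (@river_dist_triangle R).

Lemma mdist_riverE (R : realType) (v1 v2 : river_plane R) :
  mdist v1 v2 = river_dist v1 v2.
Proof. by []. Qed.

(* [{i01 R}] is the unit interval [0, 1] of [R] as a type. *)
Definition convex_structure (R : realType) (X : metricType R)
    (W : X -> X -> {i01 R} -> X) : Prop :=
  forall (x y u : X) (l : {i01 R}),
    mdist u (W x y l) <= l%:num * mdist u x + (1 - l%:num) * mdist u y.

Definition W_convex_metric_space (R : realType) (X : metricType R)
    (W : X -> X -> {i01 R} -> X) : Prop :=
  convex_structure W.
Arguments W_convex_metric_space {R} X W.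

Definition divides_in_ratio (R : realType) (v1 v2 : river_plane R)
    (l : {i01 R}) (z : river_plane R) : Prop :=
  river_dist z v1 = (1 - l%:num) * river_dist v1 v2 /\
  river_dist z v2 = l%:num * river_dist v1 v2.

(* Main.v *)
Require Import Defs.
From HB Require Import structures.
From mathcomp Require Import all_boot all_order all_algebra.
From mathcomp Require Import all_classical all_reals all_analysis.
From mathcomp Require Import ring lra.

Set Implicit Arguments.
Unset Strict Implicit.
Unset Printing Implicit Defensive.

Import Order.TTheory GRing.Theory Num.Theory.

Local Open Scope ring_scope.

(** The river plane is a tree: vertical branches attached to the horizontal
    axis.  Trees satisfy the four-point condition: of the three sums of
    opposite distances among four points, the largest is attained twice.  The
    convexity inequality and the uniqueness of the dividing point follow from
    this condition in any metric space.

    Let [z] divide [x], [y] in the ratio given by [l], and let [D] be the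
    distance from [x] to [y].  Applied to the pairs [x y] and [u z], the
    four-point condition bounds [D + d u z] by [d x u + l D] or by
    [(1 - l) D + d y u]; the triangle inequality then turns either bound into
    the convexity inequality ([four_point_convex]).  When [u] divides [x], [y]
    in the same ratio, both bounds are [D], so [d u z = 0]: the dividing point
    is unique ([four_point_unique]).

    What remains is specific to the river metric: the four-point condition
    ([river_four_point]), which reduces to that of the real line, and the
    existence of the dividing point ([river_geodesic]), found by walking along
    the path from [v1] to [v2]. *)

(** The usual maximum on the right-hand side is written as a disjunction, which
    suits linear arithmetic. *)
Definition four_point (R : realType) (X : metricType R) : Prop :=
  forall x y u z : X,
    mdist x y + mdist u z <= mdist u x + mdist z y \/
    mdist x y + mdist u z <= mdist z x + mdist u y.

Section FourPoint.
Context {R : realType} {X : metricType R}.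
Implicit Types (x y z u : X) (l : R).

Lemma four_point_convex x y z u l : four_point X -> 0 <= l <= 1 ->
  mdist z x = (1 - l) * mdist x y -> mdist z y = l * mdist x y ->
  mdist u z <= l * mdist u x + (1 - l) * mdist u y.
Proof.
move=> fp /andP[l0 l1] zx zy.
have tx := metric_triangle u y x; have ty := metric_triangle u x y.
rewrite (metric_sym y x) in tx.
have := fp x y u z; rewrite zx zy; case=> D.
- by have : 0 <= (1 - l) * (mdist x y + mdist u y - mdist u x); [
    apply: mulr_ge0; lra | lra].
- by have : 0 <= l * (mdist x y + mdist u x - mdist u y); [
    apply: mulr_ge0; lra | lra].
Qed.

Lemma four_point_unique x y z z' l : four_point X ->
  mdist z x = (1 - l) * mdist x y -> mdist z y = l * mdist x y ->
  mdist z' x = (1 - l) * mdist x y -> mdist z' y = l * mdist x y ->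
  z = z'.
Proof.
move=> fp zx zy z'x z'y; apply: mdist_positivity; apply/eqP.
rewrite eq_le mdist_ge0 andbT.
by have := fp x y z z'; rewrite zx zy z'x z'y; case=> D; lra.
Qed.

End FourPoint.

(** Whatever the signs of [x - y] and [u - z], the left-hand side is, up to a
    global sign, [(u - x) - (z - y)] or [(z - x) - (u - y)]. *)
Lemma real_four_point (R : realDomainType) (x y u z : R) :
  `|x - y| + `|u - z| <= `|u - x| + `|z - y| \/
  `|x - y| + `|u - z| <= `|z - x| + `|u - y|.
Proof.
have ux := ler_norm (u - x); have xu := ler_norm (x - u).
have zy := ler_norm (z - y); have yz := ler_norm (y - z).
have zx := ler_norm (z - x); have xz := ler_norm (x - z).
have uy := ler_norm (u - y); have yu := ler_norm (y - u).
rewrite (distrC x u) in xu; rewrite (distrC y z) in yz.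
rewrite (distrC x z) in xz; rewrite (distrC y u) in yu.
case: (ger0P (x - y)) => _; case: (ger0P (u - z)) => _.
- by right; lra.
- by left; lra.
- by left; lra.
- by right; lra.
Qed.

Section River.
Context {R : realType}.
Implicit Types (v : river_plane R).

(** The four abscissas are compared pairwise.  If all agree, the condition is
    that of the heights.  If exactly three agree, the fourth point is seen from
    their line through its foot on the river, so the condition is that of the
    heights with the fourth one replaced by 0.  In the other cases a pair on
    two lines contributes its two heights, a pair on one line at most that.  So
    if no pair on the right shares a line, what remains is the condition for the
    abscissas; if one does, no pair on the left does, and the other sum on the
    right equals the left-hand side. *)
Lemma river_four_point : four_point (river_plane R).
Proof.
move=> [x1 y1] [x2 y2] [x3 y3] [x4 y4]; rewrite !mdist_riverE /river_dist /=.
have n12 := ler_normB y1 y2; have n34 := ler_normB y3 y4.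
have fy := real_four_point y1 y2 y3 y4.
have f1 := real_four_point 0 y2 y3 y4; have f2 := real_four_point y1 0 y3 y4.
have f3 := real_four_point y1 y2 0 y4; have f4 := real_four_point y1 y2 y3 0.
rewrite ?subr0 ?sub0r ?normrN in f1 f2 f3 f4.
have d21 := distrC x2 x1; have d13 := distrC x1 x3; have d14 := distrC x1 x4.
have d23 := distrC x2 x3; have d24 := distrC x2 x4; have d43 := distrC x4 x3.
have fx := real_four_point x1 x2 x3 x4.
repeat (rewrite ?eqxx /=; case: eqVneq => [?|?]; try subst).
all: rewrite ?subrr ?normr0 in fx.
all: try solve [exact: fy
  | clear fy f1 f2 f3 f4; case: fx => fx; first [left; lra | right; lra]
  | clear fy fx f2 f3 f4; case: f1 => f1; first [left; lra | right; lra]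
  | clear fy fx f1 f3 f4; case: f2 => f2; first [left; lra | right; lra]
  | clear fy fx f1 f2 f4; case: f3 => f3; first [left; lra | right; lra]
  | clear fy fx f1 f2 f3; case: f4 => f4; first [left; lra | right; lra]].
Qed.

(** Movement towards the river along a vertical line. *)
Lemma descend (y s : R) : 0 <= s <= `|y| ->
  exists y', `|y'| = `|y| - s /\ `|y' - y| = s.
Proof.
move=> /andP[s0]; have [y0 sy|y0 sy] := ger0P y.
- exists (y - s); rewrite ger0_norm ?subr_ge0//; split=> //.
  by rewrite addrAC subrr add0r normrN ger0_norm.
- exists (y + s); rewrite ler0_norm; last by lra.
  by rewrite addrAC subrr add0r ger0_norm//; split=> //; ring.
Qed.

(** The path from [v1] to [v2] is a vertical segment if they lie on one line.
    Otherwise it descends to the river, follows it, and climbs to [v2]; the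
    point at distance [s] along it lies on the first, last or middle part
    according to whether [s] is at most [`|v1.2|], the remaining distance is at
    most [`|v2.2|], or neither.  A point of the middle part beyond its ends
    lies strictly between the two vertical lines, which decides the case of the
    river metric that applies to it.  Reversing the path makes
    [v1.1 <= v2.1] harmless to assume. *)
Lemma river_geodesic v1 v2 (s : R) : 0 <= s <= river_dist v1 v2 ->
  exists z, river_dist z v1 = s /\ river_dist z v2 = river_dist v1 v2 - s.
Proof.
wlog le12 : v1 v2 s / v1.1 <= v2.1 => [base|].
  have [|/ltW le21] := leP v1.1 v2.1; first exact: base.
  move=> /andP[s0 sD].
  have [|z [zv2 zv1]] := base _ _ (river_dist v1 v2 - s) le21.
    by rewrite (river_dist_sym v2) subr_ge0 sD lerBlDr lerDl.
  by exists z; split=> //; rewrite zv1 (river_dist_sym v2) subKr.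
case: v1 v2 le12 => [x1 y1] [x2 y2] /=; rewrite le_eqVlt => /orP[/eqP<-|lt12].
  rewrite /river_dist /= eqxx => /andP[s0 sD].
  have [ley|/ltW ley] := leP y1 y2.
    exists (x1, y1 + s) => /=; rewrite eqxx; move: sD.
    rewrite addrAC subrr add0r distrC (ger0_norm s0).
    rewrite (ger0_norm (_ : 0 <= y2 - y1)) ?subr_ge0// => sD.
    by rewrite ler0_norm; [split=> //; ring|lra].
  exists (x1, y1 - s) => /=; rewrite eqxx; move: sD.
  rewrite addrAC subrr add0r normrN (ger0_norm s0).
  rewrite (ger0_norm (_ : 0 <= y1 - y2)) ?subr_ge0// => sD.
  by rewrite ger0_norm ?subr_ge0; [split=> //; ring|lra].
rewrite /river_dist /= (lt_eqF lt12) distrC.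
rewrite (gtr0_norm (_ : 0 < x2 - x1)) ?subr_gt0//.
move=> /andP[s0 sD].
have [sy1|sy1] := leP s `|y1|.
  have [|y' [hy' dy']] := @descend y1 s; first by rewrite s0 sy1.
  exists (x1, y') => /=; rewrite eqxx (lt_eqF lt12) dy' hy' distrC.
  by rewrite (gtr0_norm (_ : 0 < x2 - x1)) ?subr_gt0//; split=> //; ring.
pose D := `|y1| + `|y2| + (x2 - x1).
have [sy2|sy2] := leP (D - s) `|y2|.
  have [|y' [hy' dy']] := @descend y2 (D - s).
    by rewrite sy2 andbT subr_ge0.
  exists (x2, y') => /=; rewrite eqxx (gt_eqF lt12) dy' hy'; split=> //.
  by rewrite (gtr0_norm (_ : 0 < x2 - x1)) ?subr_gt0// /D; ring.
exists (x1 + (s - `|y1|), 0) => /=.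
have gt1 : x1 < x1 + (s - `|y1|) by lra.
have lt2 : x1 + (s - `|y1|) < x2 by rewrite /D in sy2; lra.
rewrite (gt_eqF gt1) (lt_eqF lt2) normr0.
rewrite (gtr0_norm (_ : 0 < _ - x1)) ?subr_gt0//.
by rewrite distrC (gtr0_norm (_ : 0 < x2 - _)) ?subr_gt0//; split; ring.
Qed.

End River.

Theorem mainTheorem1 (R : realType) :
  (forall (v1 v2 : river_plane R) (l : {i01 R}),
     exists! z : river_plane R, divides_in_ratio v1 v2 l z) /\
  (forall W : river_plane R -> river_plane R -> {i01 R} -> river_plane R,
     (forall (v1 v2 : river_plane R) (l : {i01 R}),
        divides_in_ratio v1 v2 l (W v1 v2 l)) ->
     convex_structure W /\ W_convex_metric_space (river_plane R) W).
Proof.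
split=> [v1 v2 l|W divW].
- have l01 : 0 <= l%:num <= 1 by apply/andP; split.
  have D0 : 0 <= river_dist v1 v2 by rewrite -mdist_riverE mdist_ge0.
  have [|z [zv1 zv2]] :=
    @river_geodesic R v1 v2 ((1 - l%:num) * river_dist v1 v2).
    by case/andP: l01 => l0 l1; apply/andP; split; nra.
  exists z; split; first by split=> //; rewrite zv2; ring.
  move=> z' [z'v1 z'v2].
  apply: (@four_point_unique _ _ v1 v2 _ _ l%:num river_four_point) => //.
  by rewrite !mdist_riverE zv2; ring.
- suff cW : convex_structure W by split.
  move=> v1 v2 u l; have [zv1 zv2] := divW v1 v2 l.
  by apply: four_point_convex => //; [exact: river_four_point|apply/andP; split].
Qed.
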